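(* Let $\mathrm{H}$ be a finite group and $\sigma \in \mathrm{Aut}(\mathrm{H})$ with $\sigma^2 = \mathrm{Id}$. Let $\mathcal{C}$ be a union of conjugacy classes of $\mathrm{H}\rtimes_\theta \mathbb{Z}_2$, each contained in $S(\mathrm{H},\sigma)$, such that $x \in \mathcal{C}$. Then $\mathcal{C}$ is achievable.
   Context: $\mathbb{Z}_2=\{e,x\}$ and $\mathrm{H}\rtimes_\theta\mathbb{Z}_2$ is the semidirect product with $\theta(x)=\sigma$ (so $x h x = \sigma(h)$); $\mathrm{H}$ is identified with $\mathrm{H}\times\{e\}$. $S(\mathrm{H},\sigma)$ is the set of $g \in \mathrm{H}\rtimes_\theta\mathbb{Z}_2$ with $g\notin \mathrm{H}$ and $g^2=e$. Graphs are finite, simple, loopless; $N(v)$ is the neighbourhood of $v$; $\Gamma$ is reduced if $N(v)=N(w)$ implies $v=w$. For reduced $\Gamma$, $\mathrm{Aut}^{\pi}(\Gamma)$ is the group of bijections $\pi$ of $V$ such that each $\pi(N(v))$ equals some $N(w)$, and $\gamma(\pi)$ is the permutation with $N(\gamma(\pi)(v))=\pi(N(v))$; $\gamma$ is an involutive automorphism of $\mathrm{Aut}^{\pi}(\Gamma)$. An $(\mathrm{H},\sigma)$-graph is a reduced graph $\Gamma$ with a group isomorphism $\psi:\mathrm{Aut}^{\pi}(\Gamma)\to\mathrm{H}$ such that $\sigma=\psi\circ\gamma\circ\psi^{-1}$. The canonical double cover $\mathrm{B}\Gamma$ has vertex set $V\times\{0,1\}$ with $(u,i)\sim(v,j)$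 iff $(u,v)\in E$ and $i\ne j$. For connected, reduced, nonbipartite $\Gamma$, $\mathrm{Aut}(\mathrm{B}\Gamma)\cong\mathrm{Aut}^{\pi}(\Gamma)\rtimes_\gamma\mathbb{Z}_2$, via $\pi\mapsto[(v,0)\mapsto(\pi(v),0),(v,1)\mapsto(\gamma(\pi)(v),1)]$ and $x\mapsto[(v,i)\mapsto(v,1-i)]$; composing with $\psi$ gives an isomorphism $\mathrm{Aut}(\mathrm{B}\Gamma)\to\mathrm{H}\rtimes_\theta\mathbb{Z}_2$. An element $g\in\mathrm{Aut}(\mathrm{B}\Gamma)$ is strongly switching if it has order two, interchanges $V\times\{0\}$ and $V\times\{1\}$, and maps every vertex of $\mathrm{B}\Gamma$ to a vertex not adjacent to it. A subset $\mathcal{C}\subseteq S(\mathrm{H},\sigma)$ is achievable if there is a connected, reduced, nonbipartite $(\mathrm{H},\sigma)$-graph $\Gamma$ such that $\mathcal{C}$ is exactly the image of the set of strongly switching elements of $\Gamma$ under this isomorphism $\mathrm{Aut}(\mathrm{B}\Gamma)\to\mathrm{H}\rtimes_\theta\mathbb{Z}_2$. *)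

(* Defs.v *)
From mathcomp Require Import all_boot zmodp all_fingroup.
Set Implicit Arguments.
Unset Strict Implicit.
Unset Printing Implicit Defensive.
Import GroupScope.

Record sgraph := SGraph {
  svertex :> finType;
  sedge : rel svertex;
  sedge_sym : symmetric sedge;
  sedge_irrefl : irreflexive sedge }.
Arguments sedge : clear implicits.

Section Graphs.
Variable G : sgraph.

Definition nbh (v : G) : {set G} := [set w | sedge G v w].

Definition reduced := injective nbh.

Definition connected := forall u v : G, connect (sedge G) u v.

Definition bipartite :=
  exists c : G -> bool, forall u v, sedge G u v -> c u != c v.

Definition graph_aut : {set {perm G}} :=
  [set p : {perm G} | [forall u, forall v,
     sedge G (p u) (p v) == sedge G u v]].

(* Products in {perm G} are composed from left to right. The maps gamma and   *)
(* dc_lift below are multiplicative for either order, and passing to the      *)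
(* opposite group by inversion fixes every involution, so that the order does *)
(* not affect which sets of involutions are achievable.                       *)
Definition aut_pi : {set {perm G}} :=
  [set p : {perm G} | [forall v, exists w, p @: nbh v == nbh w]].

Lemma graph_aut_group_set : group_set graph_aut.
Proof.
apply/group_setP; split=> [|p q].
  by rewrite inE; apply/'forall_forallP=> u v; rewrite !perm1.
rewrite !inE => /'forall_'forall_eqP Hp /'forall_'forall_eqP Hq.
by apply/'forall_'forall_eqP=> u v; rewrite !permM Hq Hp.
Qed.
Canonical graph_aut_group := Group graph_aut_group_set.

Lemma aut_pi_group_set : group_set aut_pi.
Proof.
apply/group_setP; split=> [|p q].
  rewrite inE; apply/'forall_'exists_eqP=> v; exists v.
  by rewrite -[RHS]imset_id; apply: eq_imset => u; rewrite perm1.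
rewrite !inE => /'forall_'exists_eqP Hp /'forall_'exists_eqP Hq.
apply/'forall_'exists_eqP=> v; have [w Hw] := Hp v; have [w' Hw'] := Hq w.
exists w'; rewrite -Hw' -Hw -imset_comp.
by apply: eq_imset => u; rewrite permM.
Qed.
Canonical aut_pi_group := Group aut_pi_group_set.

(* The default value 1 is only reached when p \notin aut_pi or G is not      *)
(* reduced, see gammaP and gamma_uniq.                                       *)
Definition gamma (p : {perm G}) : {perm G} :=
  odflt 1 [pick r : {perm G} | [forall v, nbh (r v) == p @: nbh v]].

Lemma gammaP (p : {perm G}) :
  reduced -> p \in aut_pi -> forall v, nbh (gamma p v) = p @: nbh v.
Proof.
move=> redG; rewrite inE => /'forall_existsP Hp.
rewrite /gamma; case: pickP => [r /'forall_eqP //|/= no_r].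
pose f v := xchoose (Hp v).
have fE v : nbh (f v) = p @: nbh v by rewrite -(eqP (xchooseP (Hp v))).
have f_inj : injective f.
  move=> u v Euv; apply: redG; apply: (imset_inj (@perm_inj _ p)).
  by rewrite -!fE Euv.
by case/negP: (negbT (no_r (perm f_inj))); apply/'forall_eqP=> v; rewrite permE fE.
Qed.

Lemma gamma_uniq (p r : {perm G}) :
  reduced -> p \in aut_pi -> (forall v, nbh (r v) = p @: nbh v) -> gamma p = r.
Proof.
by move=> redG Hp Hr; apply/permP=> v; apply: (redG); rewrite (gammaP redG Hp) Hr.
Qed.

End Graphs.

Section DoubleCover.
Variable G : sgraph.

Definition dc_edge : rel (G * bool) :=
  [rel p q | sedge G p.1 q.1 && (p.2 != q.2)].

Lemma dc_edge_sym : symmetric dc_edge.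
Proof. by move=> p q; rewrite /dc_edge /= sedge_sym eq_sym. Qed.

Lemma dc_edge_irrefl : irreflexive dc_edge.
Proof. by move=> p; rewrite /dc_edge /= sedge_irrefl. Qed.

(* The layers V x {0} and V x {1} are indexed by false and true. *)
Definition double_cover : sgraph := SGraph dc_edge_sym dc_edge_irrefl.

Definition dc_lift_fun (p : {perm G}) (a : G * bool) : G * bool :=
  (if a.2 then gamma p a.1 else p a.1, a.2).

Lemma dc_lift_inj p : injective (dc_lift_fun p).
Proof. by case=> [u []] [v []] //= [/perm_inj->]. Qed.

Definition dc_lift (p : {perm G}) : {perm double_cover} :=
  perm (@dc_lift_inj p).

Definition dc_flip_fun (a : G * bool) : G * bool := (a.1, ~~ a.2).

Lemma dc_flip_inj : injective dc_flip_fun.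
Proof. by case=> [u i] [v j] [-> /negb_inj->]. Qed.

Definition dc_flip : {perm double_cover} := perm dc_flip_inj.

Definition strongly_switching : {set {perm double_cover}} :=
  [set g in graph_aut double_cover |
    [&& #[g] == 2,
        [forall a : double_cover, (g a).2 == ~~ a.2]
      & [forall a : double_cover, ~~ sedge double_cover a (g a)]]].

End DoubleCover.

Section SemidirectProduct.
Variables (gT : finGroupType) (H : {group gT}) (sigma : {perm gT}).
Hypotheses (sigmaAut : sigma \in Aut H) (sigma2 : sigma ^+ 2 = 1).

Definition theta_fun (h : gT) (a : 'Z_2) : gT := (sigma ^+ a) h.

Lemma theta_fun1 : theta_fun^~ 1 =1 id.
Proof. by move=> h; rewrite /theta_fun expg0 perm1. Qed.

Lemma theta_funM h : act_morph theta_fun h.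
Proof.
move=> a b; rewrite /theta_fun -permM -expgD.
by rewrite -(expg_mod (a + b) sigma2).
Qed.

Definition theta_action := TotalAction theta_fun1 theta_funM.

Lemma theta_is_groupAction : is_groupAction H theta_action.
Proof.
move=> a _; suff ->: actperm theta_action a = sigma ^+ a by apply: groupX.
by apply/permP=> h; rewrite actpermE.
Qed.

Definition theta : groupAction [set: 'Z_2]%G H :=
  GroupAction theta_is_groupAction.

Definition sdp := sdprod_by theta.

(* The generator x of the factor Z_2 (Zp1 generates the additive group Z_2). *)
Definition sdp_x : sdp := sdpair2 theta Zp1.

Lemma sdp_xJ h : h \in H ->
  sdp_x * sdpair1 theta h * sdp_x = sdpair1 theta (sigma h).
Proof.
move=> Hh; have x2 : sdp_x * sdp_x = 1.
  rewrite -sdpair2_morphM ?inE //.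
  by rewrite -[RHS](morph1 (sdpair2_morphism theta)); congr sdpair2;
    apply: val_inj.
have xV : sdp_x^-1 = sdp_x by apply/eqP; rewrite eq_invg_mul x2.
by rewrite -{1}xV -mulgA -[_ * (_ * _)]/(_ ^ sdp_x) -sdpair_act ?inE //.
Qed.

Definition switching_set : {set sdp} :=
  [set g | (g \notin sdpair1 theta @* H) && (g ^+ 2 == 1)].

Definition Hsigma_graph (G : sgraph) (psi : {morphism aut_pi G >-> gT}) :=
  [/\ reduced G,
      isom (aut_pi G) H psi
    & {in aut_pi G, forall p, psi (gamma p) = sigma (psi p)}].

(* Psi is the isomorphism Aut(BG) -> H >< Z_2 induced by psi; it is          *)
(* determined by its values on the lifts and on the flip.                    *)
Definition induced_isom (G : sgraph) (psi : {morphism aut_pi G >-> gT})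
    (Psi : {morphism graph_aut (double_cover G) >-> sdp}) :=
  [/\ isom (graph_aut (double_cover G)) [set: sdp] Psi,
      {in aut_pi G, forall p, Psi (dc_lift p) = sdpair1 theta (psi p)}
    & Psi (dc_flip G) = sdp_x].

Definition achievable (C : {set sdp}) :=
  C \subset switching_set /\
  exists (G : sgraph) (psi : {morphism aut_pi G >-> gT})
      (Psi : {morphism graph_aut (double_cover G) >-> sdp}),
    [/\ connected G, ~ bipartite G, Hsigma_graph psi,
        induced_isom psi Psi & C = Psi @: strongly_switching G].

End SemidirectProduct.

(* Main.v *)
Require Import Defs.
From HB Require Import structures.
From mathcomp Require Import all_boot zmodp all_fingroup cyclic.
Set Implicit Arguments.
Unset Strict Implicit.
Unset Printing Implicit Defensive.
Import GroupScope.

(* Put on the vertex set H * I the edges (h, i) ~ (h', j) whenever sigma(h')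
   h^-1 lies in a set T_ij. Right multiplication by a is then in Aut^pi,
   and gamma sends it to right multiplication by sigma(a). The sets T_ij
   are chosen so that nothing else is in Aut^pi: I consists of a triangle
   a, b, c with tails a - a' and b - b' - b'', so that degrees and
   adjacency to leaves tell the fibres apart, with c split into a fibre c_k
   for each k in H. All fibres are joined by perfect matchings, except that
   T_{a c_k} is the k-th member of an exhausting chain of subsets of H,
   which forces the actions on the fibres a and b to commute with left
   multiplications. Finally, T_aa = {t : t x in S \ C} makes some vertex of
   the double cover adjacent to its image under g in S exactly when g is
   not in C; the graph is loopless because x is in C. *)

(** * Two-fold automorphisms and the automorphism group of the double cover *)

(** For reduced [G] these are exactly the pairs [(p, gamma p)] with [p] in [aut_pi G]; the symmetry
    in [p] and [q] makes [gamma] an involution. *)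
Definition twofold (G : sgraph) (p q : {perm G}) :=
  forall u v, sedge G (p u) (q v) = sedge G u v.

Section Twofold.
Variable G : sgraph.
Implicit Types p q r : {perm G}.

Lemma twofoldC p q : twofold p q -> twofold q p.
Proof. by move=> pq u v; rewrite sedge_sym pq sedge_sym. Qed.

Lemma twofoldM p q p' q' :
  twofold p q -> twofold p' q' -> twofold (p * p') (q * q').
Proof. by move=> pq pq' u v; rewrite !permM pq' pq. Qed.

Lemma twofold_nbh p q v : twofold p q -> nbh (q v) = p @: nbh v.
Proof.
move=> pq; apply/setP=> w; rewrite -(permKV p w) mem_imset;
  last exact: perm_inj.
by rewrite !inE sedge_sym pq sedge_sym.
Qed.

Lemma twofold_aut_pi p q : twofold p q -> p \in aut_pi G.
Proof.
by move=> pq; rewrite inE; apply/'forall_'exists_eqP=> v; exists (q v);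
  rewrite (twofold_nbh v pq).
Qed.

Hypothesis redG : reduced G.

Lemma twofold_gamma p q : twofold p q -> gamma p = q.
Proof.
move=> pq; apply: gamma_uniq => //; first exact: twofold_aut_pi pq.
by move=> v; apply: twofold_nbh.
Qed.

Lemma gamma_twofold p : p \in aut_pi G -> twofold p (gamma p).
Proof.
move=> Ap u v; have /setP/(_ (p u)) := gammaP redG Ap v.
rewrite mem_imset; last exact: perm_inj.
by rewrite !inE (sedge_sym v) (sedge_sym (gamma p v)).
Qed.

Lemma gamma_aut_pi p : p \in aut_pi G -> gamma p \in aut_pi G.
Proof. by move/gamma_twofold/twofoldC/twofold_aut_pi. Qed.

Lemma gammaK p : p \in aut_pi G -> gamma (gamma p) = p.
Proof. by move/gamma_twofold/twofoldC/twofold_gamma. Qed.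

Lemma gammaM : {in aut_pi G &, {morph @gamma G : p q / p * q}}.
Proof.
by move=> p q Ap Aq; apply/twofold_gamma/twofoldM; apply: gamma_twofold.
Qed.

Lemma dc_liftE p v (i : bool) :
  dc_lift p (v, i) = (if i then gamma p v else p v, i).
Proof. by rewrite permE. Qed.

Lemma dc_flipE v (i : bool) : dc_flip G (v, i) = (v, ~~ i).
Proof. by rewrite permE. Qed.

Lemma dc_liftM : {in aut_pi G &, {morph @dc_lift G : p q / p * q}}.
Proof.
move=> p q Ap Aq; apply/permP=> -[v i].
by rewrite permM !dc_liftE gammaM // !permM; case: i.
Qed.

Lemma dc_lift_injective : injective (@dc_lift G).
Proof.
move=> p q pq; apply/permP=> v.
by have /permP/(_ (v, false)) := pq; rewrite !dc_liftE => -[].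
Qed.

Lemma dc_lift_conj_flip p :
  p \in aut_pi G -> dc_lift p ^ dc_flip G = dc_lift (gamma p).
Proof.
move=> Ap; apply/(mulgI (dc_flip G)); rewrite -conjgC; apply/permP=> -[v i].
by rewrite !permM !(dc_liftE, dc_flipE) gammaK //; case: i.
Qed.

Lemma dc_lift_aut p :
  p \in aut_pi G -> dc_lift p \in graph_aut (double_cover G).
Proof.
move=> /gamma_twofold pq; have qp := twofoldC pq.
rewrite inE; apply/'forall_'forall_eqP=> -[u i] [v j].
rewrite /= /dc_edge /= !dc_liftE /=.
by case: i j => -[]; rewrite //= ?andbF ?andbT ?pq ?qp.
Qed.

Lemma dc_flip_aut : dc_flip G \in graph_aut (double_cover G).
Proof.
rewrite inE; apply/'forall_'forall_eqP=> -[u i] [v j].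
by rewrite /= /dc_edge /= !dc_flipE /=; case: i j => -[].
Qed.

Lemma dc_flip2 : dc_flip G ^+ 2 = 1.
Proof. by apply/permP=> -[v i]; rewrite permM !dc_flipE perm1 negbK. Qed.

(** Edges of the double cover only join different layers, so the restrictions of [g] to the two
    layers form a two-fold pair. *)
Lemma graph_aut_layers_lift (g : {perm double_cover G}) :
  g \in graph_aut (double_cover G) -> (forall a, (g a).2 = a.2) ->
  exists2 p, p \in aut_pi G & g = dc_lift p.
Proof.
rewrite inE => /'forall_'forall_eqP autg layg.
have f_inj (i : bool) : injective (fun v : G => (g (v, i)).1).
  move=> u v uv; suff: (u, i) = (v, i) by case.
  apply: (@perm_inj _ g).
  rewrite [LHS]surjective_pairing [RHS]surjective_pairing.
  by rewrite uv !layg.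
pose f i := perm (@f_inj i).
have ff : twofold (f false) (f true).
  move=> u v; have:= autg (u, false) (v, true).
  by rewrite /= /dc_edge /= !layg !permE !andbT.
exists (f false); first exact: twofold_aut_pi ff.
apply/permP=> -[v i]; rewrite dc_liftE (twofold_gamma ff).
by rewrite [LHS]surjective_pairing layg; case: i; rewrite !permE.
Qed.

Hypotheses (conG : connected G) (nbG : ~ bipartite G).

Lemma connected_invariant (f : G -> bool) :
  (forall u v, sedge G u v -> f u = f v) -> forall u v, f u = f v.
Proof.
move=> fE u v; have /connectP[s] := conG u v.
elim: s u => [|w s IHs] u /=; first by move=> _ ->.
by case/andP=> /fE-> /IHs.
Qed.

(* If the two copies of some vertex behaved differently, then so would those of
   every vertex, and whether (v, 0) changes layer would be a bipartition. *)
Lemma graph_aut_layers (g : {perm double_cover G}) :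
  g \in graph_aut (double_cover G) ->
  exists b, forall a, (g a).2 = b (+) a.2.
Proof.
rewrite inE => /'forall_'forall_eqP autg.
pose c i (v : G) := (g (v, i)).2 (+) i.
have cE u v i : sedge G u v -> c i u = c (~~ i) v.
  move=> uv; have := autg (u, i) (v, ~~ i).
  rewrite /= /dc_edge /= uv /c.
  by case: i => /= /andP[_]; case: ((g _).2) ((g _).2) => -[].
have c01 v : c false v = c true v.
  apply/eqP/negPn/negP=> c01v.
  have c01P u : c false u (+) c true u.
    pose f w := c false w (+) c true w.
    have fE a b : sedge G a b -> f a = f b.
      by move=> ab; rewrite /f (cE _ _ _ ab) (cE _ _ true ab) addbC.
    rewrite -/(f u) (connected_invariant fE u v) /f.
    by move: c01v; case: (c false v) (c true v) => -[].
  case: nbG; exists (c false) => u w uw; rewrite (cE _ _ _ uw) /=.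
  by have := c01P w; case: (c false w) (c true w) => -[].
have [v0 _ | noG] := pickP (predT : pred G); last first.
  by exists false => -[v]; case/negP: (noG v).
exists (c false v0) => -[v i] /=.
have cv0 : c false v = c false v0.
  by apply: connected_invariant => u w /cE->; rewrite c01.
rewrite -cv0; suff -> : c false v = c i v by rewrite /c addbK.
by case: i; rewrite ?c01.
Qed.

(** An automorphism keeps or exchanges the layers as a whole; in the second case its product with
    the flip keeps them and is a lift. *)
Lemma graph_aut_dcE : graph_aut (double_cover G) =
  (@dc_lift G @: aut_pi G) * <[dc_flip G]>.
Proof.
apply/eqP; rewrite eqEsubset; apply/andP; split; last first.
  apply/subsetP=> _ /mulsgP[_ y /imsetP[p Ap ->] Fy ->].
  rewrite groupM ?dc_lift_aut //; apply: subsetP Fy.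
  by rewrite cycle_subG dc_flip_aut.
apply/subsetP=> g autg; have [[] layg] := graph_aut_layers autg.
  pose h := g * dc_flip G.
  have [|a|p Ap hp] := @graph_aut_layers_lift h.
  - by rewrite groupM ?dc_flip_aut.
  - by rewrite permM [g a]surjective_pairing dc_flipE /= layg addTb negbK.
  rewrite -(mulgK (dc_flip G) g) -/h hp mem_mulg ?groupV ?cycle_id //.
  exact: imset_f.
have [//|p Ap ->] := graph_aut_layers_lift autg.
by rewrite -[dc_lift p]mulg1 mem_mulg ?group1 ?imset_f.
Qed.

End Twofold.

(** * The isomorphism from Aut(BG) to the semidirect product *)

Lemma isom_inverse (aT rT : finGroupType) (A : {group aT}) (B : {group rT})
    (f : {morphism A >-> rT}) :
  isom A B f -> exists g : {morphism B >-> aT},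
    [/\ isom B A g, {in A, cancel f g} & {in B, cancel g f}].
Proof.
move=> isof; exists [morphism of isom_inv isof].
have [injf imf] := isomP isof.
split; first exact: isom_sym.
  by move=> x Ax; apply: invmE.
by move=> y By; apply: invmK; rewrite imf.
Qed.

Section ExtSdprodmE.
Variables gT aT rT : finGroupType.
Variables (H : {group gT}) (K : {group aT}) (to : groupAction K H).
Variables (fH : {morphism H >-> rT}) (fK : {morphism K >-> rT}).
Hypothesis actf : {in H & K, morph_act to 'J fH fK}.

Lemma xsdprodmEl h : h \in H -> xsdprodm actf (sdpair1 to h) = fH h.
Proof.
move=> Hh; rewrite /xsdprodm sdprodmEl ?mem_morphim //.
exact: (congr1 fH (invmE (injm_sdpair1 to) Hh)).
Qed.

Lemma xsdprodmEr k : k \in K -> xsdprodm actf (sdpair2 to k) = fK k.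
Proof.
move=> Kk; rewrite /xsdprodm sdprodmEr ?mem_morphim //.
exact: (congr1 fK (invmE (injm_sdpair2 to) Kk)).
Qed.
End ExtSdprodmE.

Section InducedIsom.
Variables (gT : finGroupType) (H : {group gT}) (sigma : {perm gT}).
Hypotheses (sigmaAut : sigma \in Aut H) (sigma2 : sigma ^+ 2 = 1).
Variables (G : sgraph) (psi : {morphism aut_pi G >-> gT}).
Hypotheses (conG : connected G) (nbG : ~ bipartite G).
Hypothesis Hsigma : Hsigma_graph H sigma psi.

Let redG : reduced G. Proof. by case: Hsigma. Qed.
Let isoH : isom (aut_pi G) H psi. Proof. by case: Hsigma. Qed.
Let psi_gamma : {in aut_pi G, forall p, psi (gamma p) = sigma (psi p)}.
Proof. by case: Hsigma. Qed.

Lemma flipX_morphism :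
  {in [set: 'Z_2] &, {morph (fun a : 'Z_2 => dc_flip G ^+ a) : a b / a * b}}.
Proof.
by move=> a b _ _; rewrite -expgD -(expg_mod (a + b) (dc_flip2 G)).
Qed.
Canonical flipX := Morphism flipX_morphism.

Lemma flipXE n v (i : bool) : (dc_flip G ^+ n) (v, i) = (v, odd n (+) i).
Proof.
elim: n => [|n IHn]; first by rewrite perm1.
by rewrite expgSr permM IHn dc_flipE addNb.
Qed.

(** The universal property of the semidirect product gives a map in the opposite direction, glued
    from [psi]-inverse followed by lifting and from powers of the flip; [Psi] is its inverse. *)
Lemma induced_isom_exists :
  exists Psi : {morphism graph_aut (double_cover G) >-> sdp sigmaAut sigma2},
    induced_isom psi Psi.
Proof.
(* The empty graph is bipartite, so there is a vertex [v0]; watching it tells the flip from the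
   identity. *)
have [v0 _ | noG] := pickP (predT : pred G); last first.
  by case: nbG; exists predT => v; case/negP: (noG v).
have [phi [isophi psiK phiK]] := isom_inverse isoH.
have [injphi imphi] := isomP isophi.
have Aphi h : h \in H -> phi h \in aut_pi G.
  by move=> Hh; rewrite -imphi mem_morphim.
have phiM : {in H &, {morph (fun h => dc_lift (phi h)) : h k / h * k}}.
  by move=> h k Hh Hk; rewrite morphM // dc_liftM ?Aphi.
pose fH := Morphism phiM.
have imfH : fH @* H = @dc_lift G @: aut_pi G.
  by rewrite morphimEdom -[in RHS]imphi morphimEdom -imset_comp.
have injfH : 'injm fH.
  apply/injmP=> h k Hh Hk /dc_lift_injective; exact: (injmP injphi).
have imfK : flipX @* setT = <[dc_flip G]>.
  apply/eqP; rewrite eqEsubset cycle_subG; apply/andP; split.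
    by apply/subsetP=> _ /morphimP[a _ _ ->]; apply: mem_cycle.
  rewrite -[dc_flip G]expg1.
  by apply: (mem_morphim flipX (x := Zp1)); rewrite inE.
have phi_sigma h : h \in H -> phi (sigma h) = gamma (phi h).
  by move=> Hh; rewrite -{1}(phiK h Hh) -psi_gamma ?psiK ?gamma_aut_pi ?Aphi.
have actf : {in H & [set: 'Z_2], morph_act (theta sigmaAut sigma2) 'J fH flipX}.
  move=> h a Hh _ /=; case: a => -[|[]] //= ?.
    by rewrite /theta_fun /= perm1 conjg1.
  by rewrite /theta_fun /= phi_sigma // dc_lift_conj_flip ?Aphi.
pose F := [morphism of xsdprodm actf].
have isoF : isom [set: sdp sigmaAut sigma2] (graph_aut (double_cover G)) F.
  apply/isomP; split.
    rewrite injm_xsdprodm injfH /=; apply/andP; split.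
      apply/injmP=> a b _ _ /permP/(_ (v0, false)).
      rewrite /= !flipXE => -[ab]; apply/val_inj.
      by move: a b ab => [[|[]] // ?] [[|[]] // ?].
    (* Lifts keep the layers, so a power of the flip that is a lift has an even exponent and is
       trivial. *)
    rewrite -subG1; move: imfH imfK => /= -> ->.
    apply/subsetP=> _ /setIP[/imsetP[p _ ->]].
    case/cycleP=> n /[dup] /permP/(_ (v0, false)).
    rewrite flipXE dc_liftE => -[_].
    by rewrite addbF -(expg_mod n (dc_flip2 G)) modn2 => <- ->; rewrite inE.
  by rewrite im_xsdprodm imfH imfK /= graph_aut_dcE.
have [Psi [isoPsi FK PsiK]] := isom_inverse isoF.
exists Psi; split=> // [p Ap|].
  rewrite -[in LHS](psiK p Ap) -[RHS]FK ?inE //; congr (Psi _).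
  by apply/esym/xsdprodmEl; rewrite -(isom_im isoH) mem_morphim.
rewrite -[RHS]FK ?inE //; congr (Psi _).
by apply/esym; rewrite -[RHS]expg1; apply: xsdprodmEr; rewrite inE.
Qed.
End InducedIsom.

(** * Labels of the fibres *)

Inductive fibre (T : Type) := Fa | Fa' | Fb | Fb' | Fb'' | Fc of T.
Arguments Fa {T}.
Arguments Fa' {T}.
Arguments Fb {T}.
Arguments Fb' {T}.
Arguments Fb'' {T}.

Section FibreFinite.
Variable T : finType.

Definition fibre_code (i : fibre T) :
    option (option (option (option (option T)))) :=
  match i with
  | Fa => None
  | Fa' => Some None
  | Fb => Some (Some None)
  | Fb' => Some (Some (Some None))
  | Fb'' => Some (Some (Some (Some None)))
  | Fc k => Some (Some (Some (Some (Some k))))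
  end.

Definition fibre_decode (i : option (option (option (option (option T))))) :=
  match i with
  | None => Fa
  | Some None => Fa'
  | Some (Some None) => Fb
  | Some (Some (Some None)) => Fb'
  | Some (Some (Some (Some None))) => Fb''
  | Some (Some (Some (Some (Some k)))) => Fc k
  end.

Lemma fibre_codeK : cancel fibre_code fibre_decode.
Proof. by case. Qed.

HB.instance Definition _ := Finite.copy (fibre T) (can_type fibre_codeK).
End FibreFinite.

(** * Vertex invariants of two-fold automorphisms *)

Definition twofold_invariant (G : sgraph) (A : Type) (f : G -> A) :=
  forall p q : {perm G}, twofold p q -> forall v, f (p v) = f v.

Definition nbr_sat (G : sgraph) (P : pred G) (v : G) :=
  [exists u in nbh v, P u].

Lemma twofold_degree (G : sgraph) : twofold_invariant (fun v : G => #|nbh v|).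
Proof.
move=> p q pq v; rewrite (twofold_nbh v (twofoldC pq)) card_imset //.
exact: perm_inj.
Qed.

(** The neighbours of [p v] are the [q]-images of those of [v], and [q] preserves [P] because
    [(q, p)] is two-fold as well. Iterating this from degrees yields finer invariants. *)
Lemma twofold_nbr_sat (G : sgraph) (P : pred G) :
  twofold_invariant P -> twofold_invariant (nbr_sat P).
Proof.
move=> invP p q pq v; rewrite /nbr_sat (twofold_nbh v (twofoldC pq)).
apply/exists_inP/exists_inP=> [[_ /imsetP[u vu ->]] | [u vu] Pu].
  by rewrite (invP _ _ (twofoldC pq)); exists u.
by exists (q u); rewrite ?imset_f ?(invP _ _ (twofoldC pq)).
Qed.

(** * The fibre graph: edges, neighbourhoods and degrees *)

Section FibreGraph.
Variables (T : finGroupType) (s : T -> T) (D : {set T}).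
Hypotheses (sM : {morph s : x y / x * y}) (sK : involutive s).
Hypothesis D1 : 1 \notin D.
Hypothesis DJ : forall u t, (s u * t * u^-1 \in D) = (t \in D).

(* Each pair of fibres is listed in one order only. *)
Definition half_edge (u v : T * fibre T) : bool :=
  match u.2, v.2 with
  | Fa, Fa => s v.1 * u.1^-1 \in D
  | Fa, Fc k => enum_rank (s v.1 * u.1^-1) <= enum_rank k
  | Fa, Fa' | Fa, Fb | Fb, Fc _ | Fb, Fb' | Fb', Fb'' => s v.1 == u.1
  | _, _ => false
  end.

Definition fibre_edge (u v : T * fibre T) : bool :=
  half_edge u v || half_edge v u.

Lemma fibre_edge_sym : symmetric fibre_edge.
Proof. by move=> u v; apply: orbC. Qed.

(** A loop could only occur in [Fa], where it would put [s h * h^-1], a twisted conjugate of 1, into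
    [D]. *)
Lemma fibre_edge_irrefl : irreflexive fibre_edge.
Proof.
case=> h i; rewrite /fibre_edge orbb; case: i => //=; rewrite /half_edge /=.
by rewrite -[s h]mulg1 DJ (negPf D1).
Qed.

Definition fibre_graph : sgraph := SGraph fibre_edge_sym fibre_edge_irrefl.
Local Notation G := fibre_graph.
Local Notation E := (sedge fibre_graph).

Let s1 : s 1 = 1. Proof. by apply: (mulgI (s 1)); rewrite -sM !mulg1. Qed.
Let s_inj : injective s := inv_inj sK.
Let s_eq x y : (s x == y) = (x == s y). Proof. by rewrite (inv_eq sK). Qed.

Lemma edge_aa' h h' : E (h, Fa) (h', Fa') = (h' == s h).
Proof. by rewrite /= /fibre_edge /half_edge /= orbF s_eq. Qed.
Lemma edge_ab h h' : E (h, Fa) (h', Fb) = (h' == s h).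
Proof. by rewrite /= /fibre_edge /half_edge /= orbF s_eq. Qed.
Lemma edge_bb' h h' : E (h, Fb) (h', Fb') = (h' == s h).
Proof. by rewrite /= /fibre_edge /half_edge /= orbF s_eq. Qed.
Lemma edge_b'b'' h h' : E (h, Fb') (h', Fb'') = (h' == s h).
Proof. by rewrite /= /fibre_edge /half_edge /= orbF s_eq. Qed.
Lemma edge_bc h h' k : E (h, Fb) (h', Fc k) = (h' == s h).
Proof. by rewrite /= /fibre_edge /half_edge /= orbF s_eq. Qed.
Lemma edge_ac h h' k :
  E (h, Fa) (h', Fc k) = (enum_rank (s h' * h^-1) <= enum_rank k).
Proof. by rewrite /= /fibre_edge /half_edge /= orbF. Qed.

Let edge_match := (edge_aa', edge_ab, edge_bb', edge_b'b'', edge_bc).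

Lemma nbh_a' h : nbh ((h, Fa') : G) = [set ((s h, Fa) : G)].
Proof.
apply/setP=> -[x i]; rewrite !inE sedge_sym xpair_eqE.
case: i => [|||||k]; rewrite ?andbF ?edge_aa' ?andbT //.
by rewrite eq_sym s_eq.
Qed.

Lemma nbh_b'' h : nbh ((h, Fb'') : G) = [set ((s h, Fb') : G)].
Proof.
apply/setP=> -[x i]; rewrite !inE sedge_sym xpair_eqE.
case: i => [|||||k]; rewrite ?andbF ?edge_b'b'' ?andbT //.
by rewrite eq_sym s_eq.
Qed.

Lemma nbh_b' h : nbh ((h, Fb') : G) = [set ((s h, Fb) : G); ((s h, Fb'') : G)].
Proof.
apply/setP=> -[x i]; rewrite !inE !xpair_eqE.
case: i => [|||||k]; rewrite ?andbF ?edge_b'b'' ?andbT ?orbF //.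
Qed.

Lemma nbh_b h : nbh ((h, Fb) : G) =
  [set ((s h, Fa) : G); ((s h, Fb') : G)] :|: [set ((s h, Fc k) : G) | k : T].
Proof.
apply/setP=> -[x i].
have [[k ->] | notc] : (exists k, i = Fc k) \/ (forall k, Fc k != i).
- by case: i => [|||||k]; [right..|left; exists k].
- rewrite !inE edge_bc !xpair_eqE !andbF.
  by apply/eqP/imsetP=> [-> | [l _ []//]]; exists k.
rewrite !inE !xpair_eqE [_ \in imset _ _](introF imsetP) ?orbF; last first.
  by case=> k _ [_ ik]; case/eqP: (notc k).
case: i notc => [|||||k] notc; rewrite ?andbF ?andbT ?orbF ?edge_bb' //.
by case/eqP: (notc k).
Qed.

(** The exhausting chain of subsets, each indexed by its last element in the enumeration of [T]. *)
Definition rank_below (k : T) := [set t : T | enum_rank t <= enum_rank k].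

(** Members of a chain with equal size coincide. This lets the degree separate the fibres [Fc k]. *)
Lemma rank_below_inj : injective (fun k => #|rank_below k|).
Proof.
move=> k l /= kl; wlog le_kl : k l kl / enum_rank k <= enum_rank l.
  by move=> IH; case/orP: (leq_total (enum_rank k) (enum_rank l)) => /IH ->.
have sub_kl : rank_below k \subset rank_below l.
  by apply/subsetP=> t; rewrite !inE => /leq_trans->.
have /setP/(_ l) : rank_below k = rank_below l.
  by apply/eqP; rewrite eqEcard sub_kl kl /=.
rewrite !inE leqnn => le_lk; apply/enum_rank_inj/val_inj/anti_leq.
by rewrite le_kl le_lk.
Qed.

Lemma nbh_c h k : nbh ((h, Fc k) : G) =
  ((s h, Fb) : G) |: [set ((t^-1 * s h, Fa) : G) | t in rank_below k].
Proof.
apply/setP=> -[x i].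
have [-> | nota] := eqVneq i Fa.
  rewrite !inE xpair_eqE andbF sedge_sym edge_ac.
  apply/idP/imsetP=> [lek | [t]].
    by exists (s h * x^-1); rewrite ?inE // invMg invgK mulgKV.
  by rewrite inE => le_tk [->]; rewrite invMg invgK mulKVg.
rewrite !inE !xpair_eqE [_ \in imset _ _](introF imsetP) ?orbF; last first.
  by case=> t _ [_ ia]; case/eqP: nota.
case: i nota => [|||||l] //= _; rewrite ?andbF ?andbT //.
Qed.

Lemma rank_below_gt0 k : 0 < #|rank_below k|.
Proof. by apply/card_gt0P; exists k; rewrite inE. Qed.

Lemma degree_a' h : #|nbh ((h, Fa') : G)| = 1%N.
Proof. by rewrite nbh_a' cards1. Qed.

Lemma degree_b'' h : #|nbh ((h, Fb'') : G)| = 1%N.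
Proof. by rewrite nbh_b'' cards1. Qed.

Lemma degree_b' h : #|nbh ((h, Fb') : G)| = 2%N.
Proof. by rewrite nbh_b' cards2 xpair_eqE andbF. Qed.

(** The exact degree depends on [D]; three explicit neighbours suffice to separate [Fa] from the
    fibres of degree 1 and 2. *)
Lemma degree_a h : 2 < #|nbh ((h, Fa) : G)|.
Proof.
(* The vertex [(s h, Fc 1)] is adjacent to [(h, Fa)] since the difference [s (s h) * h^-1] is 1,
   which lies in [rank_below 1]. *)
pose A := ((s h, Fc 1) : G) |: [set ((s h, Fa') : G); ((s h, Fb) : G)].
have cardA : #|A| = 3%N by rewrite cardsU1 cards2 !inE !xpair_eqE !andbF.
rewrite -cardA; apply/subset_leq_card/subsetP=> v.
rewrite !inE => /or3P[] /eqP->; rewrite ?edge_ac ?edge_match //.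
by rewrite sK mulgV.
Qed.

Lemma degree_b h : #|nbh ((h, Fb) : G)| = #|T|.+2.
Proof.
rewrite nbh_b cardsU cards2 xpair_eqE andbF card_imset => [|k l [] //].
rewrite (_ : _ :&: _ = set0) ?cards0 ?subn0 //.
by apply/setP=> v; rewrite !inE; apply/andP=> -[/orP[]/eqP-> /imsetP[? _ []]].
Qed.

Lemma degree_c h k : #|nbh ((h, Fc k) : G)| = #|rank_below k|.+1.
Proof.
rewrite nbh_c cardsU1 card_imset => [|t u [/mulIg/invg_inj] //].
by rewrite (introF imsetP) // => -[t _ []].
Qed.

(* leaf holds on a' and b'', stem on a and b', thin on b' only. *)
Let leaf (v : G) := #|nbh v| == 1%N.
Let stem := nbr_sat leaf.
Let thin (v : G) := stem v && (#|nbh v| == 2%N).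

Lemma leafE h i : leaf (h, i) = if i is (Fa' | Fb'') then true else false.
Proof.
rewrite /leaf; case: i => [|||||k].
- by have:= degree_a h; case: #|_| => [|[]].
- by rewrite degree_a'.
- by rewrite degree_b.
- by rewrite degree_b'.
- by rewrite degree_b''.
- by rewrite degree_c; case: #|_| (rank_below_gt0 k).
Qed.

Lemma stemE h i : stem (h, i) = if i is (Fa | Fb') then true else false.
Proof.
rewrite /stem /nbr_sat; case: i => [|||||k].
- by apply/exists_inP; exists (s h, Fa'); rewrite ?leafE // inE edge_match.
- by apply/exists_inP=> -[v]; rewrite nbh_a' inE => /eqP->; rewrite leafE.
- apply/exists_inP=> -[v]; rewrite nbh_b !inE.
  by case/orP=> [/orP[]/eqP-> | /imsetP[k _ ->]]; rewrite leafE.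
- by apply/exists_inP; exists (s h, Fb''); rewrite ?leafE // inE edge_match.
- by apply/exists_inP=> -[v]; rewrite nbh_b'' inE => /eqP->; rewrite leafE.
- apply/exists_inP=> -[v]; rewrite nbh_c !inE.
  by case/orP=> [/eqP-> | /imsetP[t _ ->]]; rewrite leafE.
Qed.

Lemma thinE h i : thin (h, i) = if i is Fb' then true else false.
Proof.
rewrite /thin stemE; case: i => [|||||k] //=; last by rewrite degree_b'.
by have:= degree_a h; case: #|_| => [|[|[]]].
Qed.

(** [stem] singles out [Fa] and [Fb'], which differ in degree; [Fa'] and [Fb''] have degree 1 and
    only the latter has a thin neighbour; [Fb] and the [Fc k] have pairwise different degrees, at
    least 2, that of [Fb] being the largest. *)
Lemma fibre_eq (u v : G) :
    #|nbh u| = #|nbh v| -> stem u = stem v -> nbr_sat thin u = nbr_sat thin v ->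
  u.2 = v.2.
Proof.
have thin_a' h : nbr_sat thin (h, Fa') = false.
  by apply/exists_inP=> -[w]; rewrite nbh_a' inE => /eqP->; rewrite thinE.
have thin_b'' h : nbr_sat thin (h, Fb'').
  by apply/exists_inP; exists (s h, Fb'); rewrite ?thinE // nbh_b'' inE.
have degc_b h k : #|nbh ((h, Fc k) : G)| != #|T|.+2.
  by rewrite degree_c eqSS neq_ltn ltnS max_card.
have degc1 h k : #|nbh ((h, Fc k) : G)| != 1%N by rewrite -/(leaf _) leafE.
have dega2 h : #|nbh ((h, Fa) : G)| != 2%N.
  by have:= degree_a h; case: #|_| => [|[|[]]].
case: u v => [h [|||||k]] [h' [|||||l]] //;
  rewrite ?stemE ?thin_a' ?thin_b'' //;
  rewrite ?(degree_a', degree_b, degree_b', degree_b'') => /eqP;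
  rewrite ?(eq_sym 1%N) ?(eq_sym 2%N) ?(negPf (degc1 _ _));
  rewrite ?(negPf (dega2 _)) //.
- by rewrite eq_sym (negPf (degc_b _ _)).
- by rewrite (negPf (degc_b _ _)).
- by rewrite !degree_c eqSS => /eqP/rank_below_inj->.
Qed.

Lemma twofold_fibre (p q : {perm G}) v : twofold p q -> (p v).2 = v.2.
Proof.
move=> pq; have leaf_inv : twofold_invariant leaf.
  by move=> ? ? + ?; rewrite /leaf => /twofold_degree->.
have stem_inv : twofold_invariant stem := twofold_nbr_sat leaf_inv.
have thin_inv : twofold_invariant thin.
  by move=> ? ? pq' ?; rewrite /thin (stem_inv _ _ pq') (twofold_degree pq').
apply: fibre_eq; first exact: twofold_degree pq _.
  exact: stem_inv pq _.
exact: twofold_nbr_sat thin_inv _ _ pq _.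
Qed.

(* A fibre joined to the fibre i by a perfect matching. *)
Definition mate (i : fibre T) : fibre T :=
  match i with
  | Fa => Fa'
  | Fa' => Fa
  | Fb => Fb'
  | Fb' => Fb
  | Fb'' => Fb'
  | Fc _ => Fb
  end.

Lemma edge_mate h x i : E (h, i) (x, mate i) = (x == s h).
Proof.
by case: i => [|||||k]; rewrite ?edge_match // sedge_sym edge_match eq_sym s_eq.
Qed.

(** * Reducedness, connectedness and nonbipartiteness of the fibre graph *)

(** Equal neighbourhoods give equal invariants, hence the same fibre; the matching with the mate
    fibre then recovers the group element. *)
Lemma fibre_graph_reduced : reduced G.
Proof.
move=> [h i] [h' j] uv; have ij : i = j.
  by apply: (@fibre_eq (h, i) (h', j)); rewrite /stem /nbr_sat uv.
move/setP/(_ (s h, mate i)): uv; rewrite !inE -ij !edge_mate eqxx.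
by move=> /esym/eqP/s_inj->.
Qed.

Lemma fibre_graph_connected : connected G.
Proof.
pose o : G := (1, Fa); have csym := sym_connect_sym (@sedge_sym G).
have E1 := @connect1 _ E.
have cb h : connect E o (h, Fb).
  (* With the label [h] the difference is [s (s h) = h], the last element of [rank_below h], so this
     vertex is adjacent to [o]. *)
  apply: (@connect_trans _ _ (s h, Fc h)).
    by apply: E1; rewrite edge_ac sK invg1 mulg1.
  by apply: E1; rewrite -[Fb]/(mate (Fc h)) edge_mate sK.
have step v : connect E o (s v.1, mate v.2) -> connect E o v.
  case: v => h i; move/connect_trans; apply; rewrite csym; apply: E1.
  by rewrite edge_mate.
have ca h : connect E o (h, Fa).
  apply: connect_trans (cb (s h)) _; rewrite csym; apply: E1.
  by rewrite edge_ab.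
have co v : connect E o v.
  by case: v => h [|||||k] //; apply: (step) => //; apply: (step).
by move=> u v; apply: connect_trans (co v); rewrite csym.
Qed.

Lemma fibre_graph_nbip : ~ bipartite G.
Proof.
case=> c bip.
have ab : E (1, Fa) (1, Fb) by rewrite edge_ab s1.
have bc : E (1, Fb) (1, Fc 1) by rewrite edge_bc s1.
have ac : E (1, Fa) (1, Fc 1) by rewrite edge_ac s1 invg1 mulg1.
by move: (bip _ _ ab) (bip _ _ bc) (bip _ _ ac); do 3!case: (c _).
Qed.

(** * Right multiplications, and why there are no other two-fold automorphisms *)

Lemma rmul_inj a : injective (fun v : G => (v.1 * a, v.2) : G).
Proof. by move=> [x i] [y j] [/mulIg-> ->]. Qed.
Definition rmul a : {perm G} := perm (@rmul_inj a).

Lemma rmulE a h i : rmul a (h, i) = (h * a, i).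
Proof. by rewrite permE. Qed.

Lemma rmulM : {in [set: T] &, {morph rmul : a b / a * b}}.
Proof.
by move=> a b _ _; apply/permP=> -[h i]; rewrite permM !rmulE mulgA.
Qed.

Lemma rmul_injective : injective rmul.
Proof. by move=> a b /permP/(_ (1, Fa)); rewrite !rmulE !mul1g => -[]. Qed.

(** Half-edges depend only on the labels and on [s v.1 * u.1^-1], where the factors [a] and [a^-1]
    cancel. *)
Lemma half_edge_rmul a u v :
  half_edge (rmul a u) (rmul (s a) v) = half_edge u v.
Proof.
case: u v => h i [h' j]; rewrite !rmulE /half_edge /= sM sK invMg.
by rewrite mulgA mulgK (inj_eq (mulIg a)).
Qed.

Lemma twofold_rmul a : twofold (rmul a) (rmul (s a)).
Proof.
move=> u v; rewrite /= /fibre_edge half_edge_rmul; congr (_ || _).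
by rewrite -[in rmul a u](sK a) half_edge_rmul.
Qed.

(** The two orientations give twisted conjugates of [s a] and [a^-1], so by [DJ] the answer does not
    depend on [h]. Through this [D] controls the strongly switching elements. *)
Lemma edge_rmul a h i : E (h, i) (rmul a (h, i)) =
  (i == Fa) && ((s a \in D) || (a^-1 \in D)).
Proof.
rewrite rmulE /= /fibre_edge /half_edge; case: i => [|||||k] //=.
by rewrite sM invMg mulgA !DJ.
Qed.

(** Along a perfect matching of the fibres [i] and [j], the action of [q] on [j] determines that of
    [p] on [i]. *)
Lemma twofold_mate (p q : {perm G}) a i j :
    twofold p q -> (forall h x, E (h, i) (x, j) = (x == s h)) ->
    (forall x, q (x, j) = (x * s a, j)) ->
  forall h, p (h, i) = (h * a, i).
Proof.
move=> pq Eij qj h.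
have pE : p (h, i) = ((p (h, i)).1, i).
  by rewrite [LHS]surjective_pairing (twofold_fibre _ pq).
have := pq (h, i) (s h, j); rewrite pE Eij eqxx qj Eij.
by rewrite -sM (inj_eq s_inj) => /eqP->.
Qed.

(** The matchings between [Fb] and the [Fc k] express [q] on each [Fc k] through [p] on [Fb]. The
    edges between [Fa] and all [Fc k] then make [p] preserve the quotients [y * h^-1], for [y] in
    fibre [Fb] and [h] in fibre [Fa]. *)
Lemma twofold_ab (p q : {perm G}) : twofold p q -> exists a,
  (forall h, p (h, Fa) = (h * a, Fa)) /\ (forall h, p (h, Fb) = (h * a, Fb)).
Proof.
move=> pq; have qp := twofoldC pq.
pose P i h := (p (h, i)).1; pose Q i h := (q (h, i)).1.
have pE i h : p (h, i) = (P i h, i).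
  by rewrite [LHS]surjective_pairing (twofold_fibre _ pq).
have qE i h : q (h, i) = (Q i h, i).
  by rewrite [LHS]surjective_pairing (twofold_fibre _ qp).
have PQ y (k : T) : s (Q (Fc k) (s y)) = P Fb y.
  have := pq (y, Fb) (s y, Fc k); rewrite pE qE !edge_bc eqxx => /eqP->.
  by rewrite sK.
have rank_eq y h (k : T) : (enum_rank (P Fb y * (P Fa h)^-1) <= enum_rank k)
    = (enum_rank (y * h^-1) <= enum_rank k).
  by have := pq (h, Fa) (s y, Fc k); rewrite pE qE !edge_ac PQ sK.
have P_eq y h : P Fb y * (P Fa h)^-1 = y * h^-1.
  (* Taking each of the two elements in turn as [k] gives both inequalities of ranks. *)
  by apply/enum_rank_inj/val_inj/anti_leq; rewrite rank_eq leqnn -rank_eq leqnn.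
have Pa h : P Fa h = h * P Fb 1.
  have := P_eq 1 h; rewrite mul1g => /(canRL (mulgKV _)) ->.
  by rewrite mulKVg.
exists (P Fb 1); split=> h; rewrite pE; first by rewrite Pa.
by congr (_, _); rewrite -Pa; apply/eqP; rewrite eq_mulgV1 P_eq mulgV.
Qed.

Lemma twofold_eq_rmul (p q : {perm G}) : twofold p q -> exists a, p = rmul a.
Proof.
move=> pq; have qp := twofoldC pq.
have [a [pa pb]] := twofold_ab pq; have [b [qa qb]] := twofold_ab qp.
(* The matching between [Fa] and [Fb] links the translation by [b] of [q] to that by [a] of [p]. *)
have bE : b = s a.
  have := twofold_mate (a := s b) pq edge_ab; rewrite sK => /(_ qb 1).
  by rewrite pa !mul1g => -[->]; rewrite sK.
rewrite {}bE in qa qb; exists a; apply/permP=> -[h i]; rewrite rmulE.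
have mE j := fun h x => edge_mate h x j.
(* The mate of [Fb''] is [Fb'], so reaching it takes two matchings: first for the pair [(q, p)],
   then for [(p, q)]. *)
have qb' : forall x, q (x, Fb') = (x * s a, Fb').
  by apply: twofold_mate qp (mE Fb') _; rewrite sK.
case: i => [|||||k] //.
- exact: twofold_mate pq (mE Fa') qa h.
- exact: twofold_mate pq (mE Fb') qb h.
- exact: twofold_mate pq (mE Fb'') qb' h.
- exact: twofold_mate pq (mE (Fc k)) qb h.
Qed.

End FibreGraph.

(** * The fibre graph attached to [C] and its strongly switching elements *)

Section Realisation.
Variables (gT : finGroupType) (H : {group gT}) (sigma : {perm gT}).
Hypotheses (sigmaAut : sigma \in Aut H) (sigma2 : sigma ^+ 2 = 1).
Variable C : {set sdp sigmaAut sigma2}.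
Hypothesis CJ : forall y z, (y ^ z \in C) = (y \in C).
Hypothesis CS : C \subset switching_set sigmaAut sigma2.
Hypothesis xC : sdp_x sigmaAut sigma2 \in C.

Local Notation T := (subg_of H).
Local Notation x := (sdp_x sigmaAut sigma2).

(** [subg H] is only applied inside [H], which [sigma] preserves, so its default value outside [H]
    is never reached. *)
Definition subg_sigma (t : T) : T := subg H (sigma (sgval t)).
Local Notation s := subg_sigma.

Lemma sgval_sigma t : sgval (s t) = sigma (sgval t).
Proof. by rewrite subgK // Aut_closed // subgP. Qed.

Lemma subg_sigmaM : {morph s : t u / t * u}.
Proof.
move=> t u; apply: val_inj; rewrite /= !sgval_sigma /=.
by rewrite (morphicP (Aut_morphic sigmaAut)) ?subgP.
Qed.

Lemma subg_sigmaK : involutive s.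
Proof.
move=> t; apply: val_inj; rewrite /= !sgval_sigma -permM -expg2.
by rewrite sigma2 perm1.
Qed.

Lemma subg_sigmaV t : s t^-1 = (s t)^-1.
Proof.
have s1 : s 1 = 1 by apply: (mulgI (s 1)); rewrite -subg_sigmaM !mulg1.
by apply/esym/eqP; rewrite eq_invg_mul -subg_sigmaM mulgV s1.
Qed.

Definition sd (t : T) : sdp sigmaAut sigma2 :=
  sdpair1 (theta sigmaAut sigma2) (sgval t).

Lemma sdM : {morph sd : t u / t * u}.
Proof. by move=> t u; rewrite /sd /= morphM ?subgP. Qed.

Lemma sd_inj : injective sd.
Proof.
by move=> t u /(injmP (injm_sdpair1 _) _ _ (subgP t) (subgP u)) /val_inj.
Qed.

Lemma sd1 : sd 1 = 1. Proof. exact: morph1. Qed.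

Lemma sdV t : sd t^-1 = (sd t)^-1.
Proof. by rewrite /sd morphV ?subgP. Qed.

Lemma sdp_x2 : x * x = 1.
Proof.
by have:= subsetP CS _ xC; rewrite inE expgS expg1 => /andP[_ /eqP].
Qed.

Lemma sdp_x_sd t : x * sd t = sd (s t) * x.
Proof.
apply: (mulIg x); rewrite /sd sgval_sigma -(sdp_xJ sigmaAut sigma2 (subgP t)).
by rewrite -!mulgA sdp_x2 mulg1.
Qed.

(** Moving [x] to the right turns the square into [sd (a * s a)]. *)
Lemma sdp_sq a : ((sd a * x) ^+ 2 == 1) = (s a == a^-1).
Proof.
rewrite expgS expg1 -mulgA (mulgA x) sdp_x_sd -mulgA sdp_x2 mulg1 -sdM -sd1.
by rewrite (inj_eq sd_inj) -eq_invg_mul eq_sym.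
Qed.

Definition loop_set : {set T} := [set t | (s t == t^-1) && (sd t * x \notin C)].
Local Notation D := loop_set.

Lemma loop_set1 : 1 \notin D.
Proof. by rewrite inE sd1 mul1g xC andbF. Qed.

(** Twisted conjugation of [t] is ordinary conjugation of [sd t * x] by [sd (s u)], under which [C]
    is stable. *)
Lemma loop_setJ u t : (s u * t * u^-1 \in D) = (t \in D).
Proof.
rewrite !inE; congr (_ && ~~ _).
  rewrite !subg_sigmaM subg_sigmaK subg_sigmaV !invMg invgK mulgA.
  by rewrite (inj_eq (mulIg _)) (inj_eq (mulgI _)).
rewrite -[in RHS](CJ _ (sd (s u))^-1) conjgE invgK !sdM -!mulgA.
by rewrite -!sdV sdp_x_sd subg_sigmaV subg_sigmaK.
Qed.

Local Notation G := (fibre_graph loop_set1 loop_setJ).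
Local Notation rm := (rmul loop_set1 loop_setJ).

Lemma rm_twofold a : twofold (rm a) (rm (s a)).
Proof. exact: twofold_rmul subg_sigmaM subg_sigmaK _ _ a. Qed.

Lemma realisation_reduced : reduced G.
Proof. exact: fibre_graph_reduced subg_sigmaK _ _. Qed.

Lemma rm_gamma a : gamma (rm a) = rm (s a).
Proof. exact (twofold_gamma realisation_reduced (rm_twofold a)). Qed.

Lemma aut_piP p : reflect (exists a, p = rm a) (p \in aut_pi G).
Proof.
apply: (iffP idP) => [Ap | [a ->]]; last exact: twofold_aut_pi (rm_twofold a).
have := gamma_twofold realisation_reduced Ap.
exact: twofold_eq_rmul subg_sigmaM subg_sigmaK _ _ _ _.
Qed.

(** Permutations compose from left to right, so right multiplication is a homomorphism from [H];
    [psi] is its inverse. *)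
Lemma aut_pi_isom : exists2 psi : {morphism aut_pi G >-> gT},
  Hsigma_graph H sigma psi & forall a, psi (rm a) = sgval a.
Proof.
have rhoM : {in H &, {morph (fun h => rm (subg H h)) : h k / h * k}}.
  by move=> h k Hh Hk; rewrite subgM // rmulM ?inE.
pose rho := Morphism rhoM.
have iso_rho : isom H (aut_pi G) rho.
  apply/isomP; split.
    apply/injmP=> h k Hh Hk /rmul_injective hk.
    by have := congr1 sgval hk; rewrite !subgK.
  apply/setP=> p; apply/morphimP/aut_piP => [[h _ _ ->] | [a ->]].
    by exists (subg H h).
  by exists (sgval a); rewrite ?subgP //= sgvalK.
have [psi [iso_psi rhoK _]] := isom_inverse iso_rho.
have psiE a : psi (rm a) = sgval a.
  by rewrite -[RHS]rhoK ?subgP //= sgvalK.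
exists psi => //; split=> // [|p /aut_piP[a ->]].
  exact: realisation_reduced.
by rewrite rm_gamma !psiE sgval_sigma.
Qed.

(** This element acts as [rm a] on one layer and as [rm (s a)] on the other while exchanging them;
    [edge_rmul] for each layer yields two of the conditions on [D]. *)
Lemma strongly_switching_lift a :
  (dc_lift (rm a) * dc_flip G \in strongly_switching G) =
  [&& dc_lift (rm a) * dc_flip G \in graph_aut (double_cover G),
      (dc_lift (rm a) * dc_flip G) ^+ 2 == 1,
      s a \notin D, a^-1 \notin D, a \notin D & (s a)^-1 \notin D].
Proof.
set g := _ * _.
have gE h i (b : bool) :
    g ((h, i), b) = (rm (if b then s a else a) (h, i), ~~ b).
  by rewrite permM dc_liftE dc_flipE rm_gamma; case: b.
rewrite inE (_ : [forall a, (g a).2 == _] = true) ?andTb; last first.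
  by apply/forallP=> -[[h i] b]; rewrite gE.
congr (_ && (_ && _)).
  apply/eqP/eqP=> [<- | g2]; first exact: expg_order.
  apply: nt_prime_order => //; apply/eqP=> /permP/(_ ((1, Fa), false)).
  by rewrite gE perm1 => -[].
have edgeE b h i : sedge (double_cover G) ((h, i), b) (g ((h, i), b)) =
    (i == Fa) && ((s (if b then s a else a) \in D)
      || ((if b then s a else a)^-1 \in D)).
  rewrite gE -(edge_rmul subg_sigmaM loop_set1 loop_setJ _ h i).
  by rewrite [LHS]/= /dc_edge /=; case: b; rewrite andbT.
apply/forallP/and4P=> [noE | [aD1 aD2 aD3 aD4] [[h i] b]]; last first.
  rewrite edgeE negb_and negb_or; apply/orP; right.
  by case: b; rewrite ?subg_sigmaK ?aD1 ?aD2 ?aD3 ?aD4.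
have := noE ((1, Fa), false); rewrite edgeE eqxx negb_or => /andP[-> ->].
have := noE ((1, Fa), true); rewrite edgeE eqxx negb_or subg_sigmaK.
by move=> /andP[-> ->].
Qed.

Lemma realisation_achievable : achievable C.
Proof.
split=> //; have [psi Hsig psiE] := aut_pi_isom.
have conG : connected G by apply: fibre_graph_connected subg_sigmaK _ _.
have nbG : ~ bipartite G by apply: fibre_graph_nbip subg_sigmaM subg_sigmaK _ _.
have [Psi indPsi] := induced_isom_exists sigmaAut sigma2 conG nbG Hsig.
exists G, psi, Psi; split=> //; have [isoPsi PsiL PsiF] := indPsi.
have [injPsi imPsi] := isomP isoPsi.
have rmA a : rm a \in aut_pi G by apply/aut_piP; exists a.
have autL a : dc_lift (rm a) \in graph_aut (double_cover G).
  exact (dc_lift_aut realisation_reduced (rmA a)).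
have autF := dc_flip_aut G.
have Psi_lift a : Psi (dc_lift (rm a)) = sd a by rewrite PsiL ?psiE.
have autPsi g : g \in graph_aut (double_cover G) ->
    (g \in strongly_switching G) = (Psi g \in C).
  rewrite {1}graph_aut_dcE //; last exact: realisation_reduced.
  case/mulsgP=> _ _ /imsetP[_ /aut_piP[a ->] ->] /cycleP[n ->] ->.
  (* For even [n] both sides fail: a lift does not exchange the layers, and its image lies in [H],
     hence outside [C]. *)
  rewrite -(expg_mod n (dc_flip2 G)) modn2; case: (odd n); last first.
    rewrite mulg1 Psi_lift; transitivity false.
      rewrite !inE; apply/and3P=> -[_ _ /andP[/forallP/(_ ((1, Fa), false))]].
      by rewrite dc_liftE.
    apply/esym/negP=> /(subsetP CS); rewrite inE => /andP[/negP[]].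
    by rewrite mem_morphim ?subgP.
  rewrite strongly_switching_lift groupM //= morphM // Psi_lift PsiF.
  have g2E : ((dc_lift (rm a) * dc_flip G) ^+ 2 == 1) = (s a == a^-1).
    rewrite -(inj_in_eq (injmP injPsi)) ?groupX ?groupM ?group1 //.
    by rewrite morphX ?groupM // morph1 morphM // Psi_lift PsiF sdp_sq.
  rewrite g2E; have [sa | sa] /= := eqVneq (s a) a^-1; last first.
    apply/esym/negP=> /(subsetP CS); rewrite inE => /andP[_].
    by rewrite sdp_sq; apply/negP.
  (* Here [a^-1 = s a * a * a^-1] is a twisted conjugate of [a], so all four conditions reduce to
     [a \notin D], that is, to [sd a * x \in C]. *)
  have aV : (a^-1 \in D) = (a \in D) by rewrite -(loop_setJ a a) mulgK sa.
  by rewrite sa invgK aV !andbb inE sa eqxx /= negbK.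
apply/setP=> z; apply/idP/imsetP=> [zC | [g SSg ->]].
  have : z \in Psi @* graph_aut (double_cover G) by rewrite imPsi inE.
  by case/morphimP=> g _ autg zE; exists g => //; rewrite autPsi // -zE.
by rewrite -autPsi //; move: SSg; rewrite inE => /andP[].
Qed.

End Realisation.

Theorem theorem9p5 (gT : finGroupType) (H : {group gT}) (sigma : {perm gT})
  (sigmaAut : sigma \in Aut H) (sigma2 : sigma ^+ 2 = 1)
  (K : {set {set sdp sigmaAut sigma2}}) (C : {set sdp sigmaAut sigma2})
  (Kclasses : K \subset classes [set: sdp sigmaAut sigma2])
  (KS : forall A, A \in K -> A \subset switching_set sigmaAut sigma2)
  (CK : C = \bigcup_(A in K) A)
  (xC : sdp_x sigmaAut sigma2 \in C) :
  achievable C.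
Proof.
have CJ y z : (y ^ z \in C) = (y \in C).
  have AJ A : A \in K -> (y ^ z \in A) = (y \in A).
    case/(subsetP Kclasses)/imsetP=> w _ ->.
    exact: class_transl (memJ_class _ (in_setT z)).
  by rewrite CK; apply/bigcupP/bigcupP=> -[A KA yA]; exists A;
    rewrite // ?AJ // -AJ.
have CS : C \subset switching_set sigmaAut sigma2.
  by rewrite CK; apply/bigcupsP=> A /KS.
exact: realisation_achievable CJ CS xC.
Qed.
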